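(* Let $u:\mathbb{Z}^d\to\mathbb{R}$ be a harmonic polynomial of degree $M$. Let $0\le\varepsilon<0.5$. Then $$Q_u(2n)\le\sqrt{e^{n^{-2\varepsilon}}Q_u(n)Q_u(4n)}$$ for all $n\in\mathbb{N}$ such that $n^{1-2\varepsilon}>M^2$ and $n>16$.
   Context: A harmonic polynomial on $\mathbb{Z}^d$ of degree $M$ is the restriction $u$ to $\mathbb{Z}^d$ of a real polynomial of degree $M$ in $d$ variables satisfying $\Delta u\equiv0$ on $\mathbb{Z}^d$, where $(\Delta u)(x)=\frac{1}{2d}\sum_{y\sim x}(u(y)-u(x))$ and $y\sim x$ means nearest neighbours. $(X_n)_{n\ge0}$ is the simple random walk on $\mathbb{Z}^d$ starting at $0$, and $Q_u(n):=\mathbb{E}(u(X_n)^2)$. *)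

(* Defs.v *)
From HB Require Import structures.
From mathcomp Require Import all_boot all_order all_algebra.
From mathcomp Require Import all_classical all_reals all_analysis.
(* The notations of mpoly clash with those of MathComp-Analysis. *)
From mathcomp Require Import -(notations) mpoly.

Set Implicit Arguments.
Unset Strict Implicit.
Unset Printing Implicit Defensive.

Import Order.TTheory GRing.Theory Num.Theory.
Local Open Scope classical_set_scope.
Local Open Scope ring_scope.

(* Z^d is 'rV[int]_d; the sequence is duplicate-free and has 2d entries. *)
Definition neighbours (d : nat) (x : 'rV[int]_d) : seq 'rV[int]_d :=
  [seq x + delta_mx 0 i | i : 'I_d] ++ [seq x - delta_mx 0 i | i : 'I_d].

Definition laplacian (R : realType) (d : nat) (u : 'rV[int]_d -> R)
    (x : 'rV[int]_d) : R :=
  (2 * d)%:R^-1 * \sum_(y <- neighbours x) (u y - u x).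

(* [msize p] is one more than the total degree of [p], and 0 for p = 0,
   so the zero polynomial counts as having degree 0. *)
Definition harmonic_polynomial (R : realType) (d M : nat)
    (u : 'rV[int]_d -> R) : Prop :=
  (exists p : mpoly d R,
     (msize p).-1 = M /\
     forall x, u x = meval (fun i => (x 0 i)%:~R) p) /\
  forall x, laplacian u x = 0.

Definition step_prob (R : realType) (d : nat) (x y : 'rV[int]_d) : R :=
  if y \in neighbours x then (2 * d)%:R^-1 else 0.

(* The Markov chain on Z^d with initial law the Dirac mass at 0 and transition
   probabilities [step_prob], given by its finite-dimensional laws. Since Z^d
   is countable, measurability of the fibres is measurability of each X_n for
   the discrete sigma-algebra. *)
Definition simple_random_walk (R : realType) (d : nat)
    (disp : measure_display) (T : measurableType disp) (P : probability T R)
    (X : nat -> T -> 'rV[int]_d) : Prop :=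
  (forall n x, measurable [set w | X n w = x]) /\
  forall (n : nat) (x : nat -> 'rV[int]_d),
    P [set w | forall k, (k <= n)%N -> X k w = x k] =
      ((x 0%N == 0)%:R * \prod_(k < n) step_prob R (x k) (x k.+1))%:E.

(* For a walk in the sense above X_n takes finitely many values almost surely,
   so the expectation is finite and [fine] loses nothing. *)
Definition Q (R : realType) (d : nat)
    (disp : measure_display) (T : measurableType disp) (P : probability T R)
    (X : nat -> T -> 'rV[int]_d) (u : 'rV[int]_d -> R) (n : nat) : R :=
  fine 'E_P[fun w => (u (X n w) ^+ 2)%R]%E.

(* Main.v *)
Require Import Defs.
From HB Require Import structures.
From mathcomp Require Import all_boot all_order all_algebra.
From mathcomp Require Import all_classical all_reals all_analysis.
From mathcomp Require Import -(notations) mpoly.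
From mathcomp Require Import measurable_realfun ring lra zify.
Import Order.TTheory GRing.Theory Num.Theory.
Local Open Scope ring_scope.

(* For harmonic u one has E[u(X_{n+1})^2] - E[u(X_n)^2] = (2d)^-1 sum_e
   E[(D_e u)(X_n)^2], where the differences D_e u are again harmonic
   polynomials, of degree one less. Hence Q_u(n) = sum_{k <= M} a_k C(n, k) with
   all a_k >= 0. The theorem then follows from Cauchy-Schwarz and the termwise
   bound C(2n, k)^2 <= (1 + M/n)^k C(n, k) C(4n, k), because
   (1 + M/n)^M <= exp(M^2/n) <= exp(n^(-2 eps)). *)

Set Implicit Arguments.
Unset Strict Implicit.

(** * Steps of the walk and the averaging operator *)

Notation direction d := ('I_d + 'I_d)%type.

Definition unit_step {d : nat} (e : direction d) : 'rV[int]_d :=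
  match e with inl i => delta_mx 0 i | inr i => - delta_mx 0 i end.

Lemma unit_step_inj d : injective (@unit_step d).
Proof.
case=> [i|i] [j|j] /= /rowP /(_ i); rewrite !mxE !eqxx /=.
all: case: (eqVneq i j) => [->|] //=; lia.
Qed.

Lemma mem_neighbours d (x : 'rV[int]_d) (e : direction d) :
  x + unit_step e \in neighbours x.
Proof.
rewrite mem_cat; case: e => i /=; apply/orP.
  by left; apply: (fintype.image_f (fun i => x + delta_mx 0 i)).
by right; apply: (fintype.image_f (fun i => x - delta_mx 0 i)).
Qed.

Lemma big_neighbours (R : nmodType) d (x : 'rV[int]_d) (g : 'rV[int]_d -> R) :
  \sum_(y <- neighbours x) g y = \sum_(e : direction d) g (x + unit_step e).
Proof. by rewrite big_cat !big_image /= big_sumType. Qed.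

(** The transition operator of the walk, equal for d > 0 to the identity plus [laplacian]. Indexing
    by steps instead of neighbours lets its iterates expand into sums over words of steps. *)
Definition neighbour_mean {R : realType} {d : nat} (f : 'rV[int]_d -> R)
    (x : 'rV[int]_d) : R :=
  (2 * d)%:R^-1 * \sum_(e : direction d) f (x + unit_step e).

Lemma card_direction d : #|{: direction d}| = (2 * d)%N.
Proof. by rewrite card_sum card_ord addnn mul2n. Qed.

Lemma iter_neighbour_meanE {R : realType} {d : nat} n
    (f : 'rV[int]_d -> R) x :
  iter n neighbour_mean f x =
    (2 * d)%:R^-1 ^+ n *
      \sum_(w : n.-tuple (direction d)) f (x + \sum_(e <- w) unit_step e).
Proof.
elim: n x => [|n IHn] x.
  rewrite expr0 mul1r (big_pred1 [tuple]) => [|w]; last exact/esym/eqP/tuple0.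
  by rewrite big_nil addr0.
rewrite iterS /neighbour_mean exprS -mulrA; congr (_ * _).
under eq_bigr do rewrite IHn.
rewrite -big_distrr /=; congr (_ * _).
rewrite pair_big /=.
rewrite [RHS](reindex (fun p : direction d * n.-tuple (direction d) =>
  [tuple of p.1 :: p.2])) /=.
  by apply: eq_bigr => p _; rewrite big_cons addrA.
exists (fun w : n.+1.-tuple (direction d) => (thead w, [tuple of behead w])) => [[e w] _|w _] /=.
  by rewrite theadE; congr pair; apply: val_inj.
by rewrite -tuple_eta.
Qed.

(** * The law of the walk, as a uniform law on words of steps *)

Section Walk.
Context (R : realType) (d : nat) (hd : (0 < d)%N)
    (disp : measure_display) (T : measurableType disp) (P : probability T R)
    (X : nat -> T -> 'rV[int]_d) (hX : simple_random_walk P X).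
Local Open Scope classical_set_scope.

Let pos (w : seq (direction d)) (k : nat) : 'rV[int]_d :=
  \sum_(e <- take k w) unit_step e.

Let history n (w : seq (direction d)) : set T :=
  [set om | forall k, (k <= n)%N -> X k om = pos w k].

Let posS e0 (w : seq (direction d)) k : (k < size w)%N ->
  pos w k.+1 = pos w k + unit_step (nth e0 w k).
Proof. by move=> kw; rewrite /pos (take_nth e0)// -cats1 big_cat big_seq1. Qed.

Let P_history n (w : n.-tuple (direction d)) :
  P (history n w) = ((2 * d)%:R^-1 ^+ n)%:E.
Proof.
rewrite (hX.2 n (pos w)); congr EFin.
rewrite (_ : pos w 0 = 0) ?eqxx ?mul1r; last by rewrite /pos take0 big_nil.
rewrite (eq_bigr (fun=> (2 * d)%:R^-1)) => [|k _].
  by rewrite prodr_const card_ord.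
by rewrite /step_prob (@posS (tnth w k)) ?size_tuple// mem_neighbours.
Qed.

Let measurable_history n w : measurable (history n w).
Proof.
rewrite (_ : history n w = \bigcap_(k in `I_n.+1) [set om | X k om = pos w k]).
  by apply: fin_bigcap_measurable => // k _; exact: hX.1.
by apply/seteqP; split=> om h k; exact: h.
Qed.

(** A word is determined by its positions: consecutive differences give its letters, as [unit_step]
    is injective. *)
Let trivIset_history n (D : set (n.-tuple (direction d))) :
  trivIset D (fun w => history n w).
Proof.
move=> w w' _ _ [om /= [h h']] {D}; apply: val_inj => /=.
(* Comparing letters with [nth] needs a default letter, which only a nonempty word supplies. *)
case: n w w' h h' => [|n] w w' h h'; first by rewrite (tuple0 w) (tuple0 w').
apply: (@eq_from_nth _ (thead w)) => [|k]; rewrite !size_tuple// => kn.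
apply: unit_step_inj; apply: (addrI (pos w k)).
rewrite -posS ?size_tuple// -h// h'//.
by rewrite -h 1?ltnW// h' 1?ltnW// -posS ?size_tuple.
Qed.

(** Since Z^d is countable, any preimage is a countable union of fibres of [X n], indexed here by
    the codes of points. *)
Lemma measurable_comp_walk (f : 'rV[int]_d -> R) n :
  measurable_fun setT (fun om => f (X n om)).
Proof.
move=> _ B mB; rewrite setTI.
rewrite (_ : _ @^-1` B = \bigcup_k
   (if unpickle k is Some x then [set om | X n om = x /\ B (f x)] else set0)).
  apply: bigcupT_measurable => k; case: unpickle => // x.
  have [Bx|nBx] := pselect (B (f x)).
    rewrite (_ : mkset _ = [set om | X n om = x]); first exact: hX.1.
    by apply/seteqP; split=> om /= [].
  rewrite (_ : mkset _ = set0); first exact: measurable0.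
  by apply/seteqP; split=> om /= [].
apply/seteqP; split=> om /=.
  by move=> Bf; exists (pickle (X n om)) => //; rewrite pickleK.
by case=> k _; case: unpickle => // x [->].
Qed.

(** The (2d)^n histories of length n are disjoint and each has mass (2d)^-n, so they carry the whole
    probability; on each of them the integrand is constant. *)
Lemma expectation_walk (f : 'rV[int]_d -> R) n : (forall x, 0 <= f x) ->
  ('E_P[fun om => f (X n om)] = (iter n neighbour_mean f 0)%:E)%E.
Proof.
move=> f0; rewrite unlock iter_neighbour_meanE//.
pose U := \big[setU/set0]_(w <- index_enum {: n.-tuple (direction d)}) history n w.
have mU : measurable U by exact: bigsetU_measurable.
have d0 : (2 * d)%:R != 0 :> R by rewrite pnatr_eq0 -lt0n muln_gt0.
have PU : P U = 1%E.
  rewrite /U -bigcup_seq measure_fin_bigcup//; last exact: trivIset_history.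
  rewrite -fsbig_seq ?index_enum_uniq// (eq_bigr (fun=> ((2 * d)%:R^-1 ^+ n)%:E)) => [|w _]; last exact: P_history.
  rewrite sumEFin sumr_const card_tuple card_direction -[X in X%:E]mulr_natl natrX.
  by rewrite -exprMn mulfV// expr1n.
(* The complement of [U] is a null set, so the integral may be restricted to [U]. *)
rewrite [LHS](@ge0_negligible_integral _ _ _ P setT (~` U))//; first last.
- rewrite -[LHS]/(P (~` U)) probability_setC// PU subee//.
- by move=> om _; rewrite lee_fin.
- by apply/measurable_EFinP; exact: measurable_comp_walk.
- exact: measurableC.
rewrite setTD setCK integral_bigsetU_EFin ?index_enum_uniq//; first last.
- by apply: measurable_funTS; apply/measurable_EFinP; exact: measurable_comp_walk.
- exact: trivIset_history.
rewrite big_distrr /= -sumEFin; apply: eq_bigr => w _.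
rewrite (eq_integral (cst (f (0 + \sum_(e <- w) unit_step e))%:E)) => [|om].
  rewrite [LHS]integral_cst// -[X in (_ * X)%E]/(P (history n w)) P_history.
  by rewrite -EFinM mulrC.
rewrite inE => /(_ n (leqnn n)) ->.
by rewrite /pos take_oversize ?size_tuple// add0r.
Qed.

End Walk.

(** * Difference calculus and the growth of the mean of a squared harmonic polynomial *)

Section Differences.
Context {R : realType} {d : nat}.
Implicit Types (f g u v : 'rV[int]_d -> R) (x : 'rV[int]_d) (e : direction d).

Definition diff e u x : R := u (x + unit_step e) - u x.

(** Degree at most m, encoded by iterated differences becoming constant after m of them. A
    difference then lowers the degree by definition, which suits the induction on the degree of a
    harmonic polynomial. *)
Fixpoint diff_degree_le (m : nat) u : Prop :=
  if m is k.+1 then forall e, diff_degree_le k (diff e u)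
  else forall e x, u (x + unit_step e) = u x.

Lemma eq_diff_degree_le m u v : u =1 v -> diff_degree_le m u -> diff_degree_le m v.
Proof. by move=> /funext ->. Qed.

Lemma diff_degree_leS m u : diff_degree_le m u -> diff_degree_le m.+1 u.
Proof.
elim: m u => [|m IHm] u hu e; last exact: IHm.
by move=> e' x; rewrite /diff !hu.
Qed.

Lemma diff_degree_leD m u v :
  diff_degree_le m u -> diff_degree_le m v -> diff_degree_le m (fun x => u x + v x).
Proof.
elim: m u v => [|m IHm] u v hu hv e; first by move=> x; rewrite hu hv.
apply: (@eq_diff_degree_le _ (fun x => diff e u x + diff e v x)); last exact: IHm.
by move=> x; rewrite /diff; ring.
Qed.

Lemma diff_degree_le_cst m (c : R) : diff_degree_le m (fun=> c).
Proof. by elim: m => [|m IHm] //; exact: diff_degree_leS. Qed.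

Lemma diff_degree_le_sum m (I : eqType) (r : seq I) (F : I -> 'rV[int]_d -> R) :
  {in r, forall i, diff_degree_le m (F i)} ->
  diff_degree_le m (fun x => \sum_(i <- r) F i x).
Proof.
elim: r => [|i r IHr] hF.
  by apply: eq_diff_degree_le (diff_degree_le_cst m 0) => x; rewrite big_nil.
apply: (@eq_diff_degree_le _ (fun x => F i x + \sum_(j <- r) F j x)).
  by move=> x; rewrite big_cons.
apply: diff_degree_leD; first by apply: hF; rewrite mem_head.
by apply: IHr => j jr; apply: hF; rewrite in_cons jr orbT.
Qed.

Lemma diff_degree_le_shift m e u :
  diff_degree_le m u -> diff_degree_le m (fun x => u (x + unit_step e)).
Proof.
case: m => [|m] hu; first by move=> e' x; rewrite !hu.
apply: eq_diff_degree_le (diff_degree_leD hu (diff_degree_leS (hu e))) => x.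
by rewrite /diff addrC subrK.
Qed.

(** Discrete Leibniz rule. The two terms lower the degree of different factors, hence the induction
    on the sum of the degrees. *)
Lemma diff_degree_leM m n u v : diff_degree_le m u -> diff_degree_le n v ->
  diff_degree_le (m + n) (fun x => u x * v x).
Proof.
have [N] := ubnP (m + n); elim: N m n u v => // N IHN m n u v mnN hu hv.
case E : (m + n)%N => [|k] e.
  move: E hu hv => /eqP; rewrite addn_eq0 => /andP[/eqP-> /eqP->] hu hv x.
  by rewrite hu hv.
have -> : diff e (fun x => u x * v x) =
    (fun x => diff e u x * v (x + unit_step e) + u x * diff e v x).
  by apply/funext => x; rewrite /diff; ring.
apply: diff_degree_leD.
  (* A factor of degree 0 has zero difference, so its term vanishes and no predecessor of the degree
     is needed. *)
  case: m E hu mnN => [|m] E hu mnN.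
    by apply: eq_diff_degree_le (diff_degree_le_cst k 0) => x;
      rewrite /diff hu subrr mul0r.
  have -> : k = (m + n)%N by lia.
  by apply: IHN; [lia | exact: hu | exact: diff_degree_le_shift].
case: n E hv mnN => [|n] E hv mnN.
  by apply: eq_diff_degree_le (diff_degree_le_cst k 0) => x;
    rewrite /diff hv subrr mulr0.
have -> : k = (m + n)%N by lia.
by apply: IHN; [lia | | exact: hv].
Qed.

Lemma diff_degree_le_coord (i : 'I_d) :
  diff_degree_le 1 (fun x => (x 0 i)%:~R : R).
Proof.
by move=> e e' x; rewrite /diff !mxE; ring.
Qed.

Lemma diff_degree_leW m n u : (m <= n)%N -> diff_degree_le m u -> diff_degree_le n u.
Proof.
by move=> /subnK <- hu; elim: (n - m)%N => // k; exact: diff_degree_leS.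
Qed.

Lemma diff_degree_leX m n u : diff_degree_le m u ->
  diff_degree_le (m * n) (fun x => u x ^+ n).
Proof.
move=> hu; elim: n => [|n IHn].
  by apply: eq_diff_degree_le (diff_degree_le_cst _ 1) => x; rewrite expr0.
rewrite mulnS; apply: eq_diff_degree_le (diff_degree_leM hu IHn) => x.
by rewrite exprS.
Qed.

Lemma diff_degree_le_prod (I : Type) (r : seq I) (m : I -> nat)
    (F : I -> 'rV[int]_d -> R) : (forall i, diff_degree_le (m i) (F i)) ->
  diff_degree_le (\sum_(i <- r) m i) (fun x => \prod_(i <- r) F i x).
Proof.
move=> hF; elim: r => [|i r IHr].
  by apply: eq_diff_degree_le (diff_degree_le_cst _ 1) => x; rewrite big_nil.
rewrite big_cons.
by apply: eq_diff_degree_le (diff_degree_leM (hF i) IHr) => x; rewrite big_cons.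
Qed.

(** Each monomial is a product of coordinates, which have degree at most 1, so the product rule
    bounds it by its total degree. *)
Lemma diff_degree_le_meval (p : mpoly d R) :
  diff_degree_le (msize p).-1 (fun x => meval (fun i => (x 0 i)%:~R) p).
Proof.
apply: (@eq_diff_degree_le _ (fun x => \sum_(m <- msupp p)
  mcoeff m p * \prod_i (x 0 i)%:~R ^+ m i)); first by move=> x; rewrite mevalE.
apply: diff_degree_le_sum => m hm.
apply: (@diff_degree_leW (mdeg m)).
  by have := msize_mdeg_lt hm; case: (msize p).
rewrite -[mdeg m]add0n; apply: diff_degree_leM; first exact: diff_degree_le_cst.
rewrite mdegE; apply: diff_degree_le_prod => i.
by rewrite -[X in diff_degree_le X]mul1n; apply: diff_degree_leX; exact: diff_degree_le_coord.
Qed.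

Lemma neighbour_meanB f g x :
  neighbour_mean f x - neighbour_mean g x = neighbour_mean (fun y => f y - g y) x.
Proof. by rewrite /neighbour_mean -mulrBr -sumrB. Qed.

Lemma iter_neighbour_meanB n f g x :
  iter n neighbour_mean f x - iter n neighbour_mean g x =
  iter n neighbour_mean (fun y => f y - g y) x.
Proof.
elim: n x => // n IHn x; rewrite !iterS neighbour_meanB.
by congr (neighbour_mean _ _); apply/funext => y; rewrite IHn.
Qed.

Lemma iter_neighbour_mean_average n (F : direction d -> 'rV[int]_d -> R) x :
  iter n neighbour_mean (fun y => (2 * d)%:R^-1 * \sum_e F e y) x =
  (2 * d)%:R^-1 * \sum_e iter n neighbour_mean (F e) x.
Proof.
elim: n x => // n IHn x; rewrite iterS {1}/neighbour_mean.
under eq_bigr do rewrite IHn.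
rewrite -big_distrr /= exchange_big /=; congr (_ * _).
by rewrite big_distrr.
Qed.

Context (hd : (0 < d)%N).

Let d0 : (2 * d)%:R != 0 :> R.
Proof. by rewrite pnatr_eq0 -lt0n muln_gt0. Qed.

Lemma neighbour_mean_cst (c : R) x : neighbour_mean (fun=> c) x = c.
Proof.
by rewrite /neighbour_mean sumr_const card_direction -(mulr_natl c) mulKf.
Qed.

Lemma harmonic_sum_diff u x : laplacian u x = 0 -> \sum_e diff e u x = 0.
Proof.
by rewrite /laplacian big_neighbours => /eqP; rewrite mulf_eq0 invr_eq0 (negPf d0) => /eqP.
Qed.

(** The Laplacian commutes with translations. *)
Lemma harmonic_diff u e : (forall x, laplacian u x = 0) ->
  forall x, laplacian (diff e u) x = 0.
Proof.
move=> hu x; rewrite /laplacian big_neighbours.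
rewrite (eq_bigr (fun e' => diff e' u (x + unit_step e) - diff e' u x)).
  by rewrite sumrB !harmonic_sum_diff// subrr mulr0.
by move=> e' _; rewrite /diff (addrAC x); ring.
Qed.

(** With D = [diff e u x], one has u(x + e)^2 - u(x)^2 = D^2 + 2 u(x) D, and harmonicity cancels the
    sum of the linear terms. *)
Lemma neighbour_mean_sqr_harmonic u : (forall x, laplacian u x = 0) -> forall x,
  neighbour_mean (fun y => u y ^+ 2) x - u x ^+ 2 =
  (2 * d)%:R^-1 * \sum_e diff e u x ^+ 2.
Proof.
move=> hu x; rewrite -[X in _ - X](neighbour_mean_cst _ x) neighbour_meanB.
congr (_ * _).
rewrite (eq_bigr (fun e => diff e u x ^+ 2 + diff e u x * (2 * u x))).
  by rewrite big_split /= -big_distrl /= harmonic_sum_diff// mul0r addr0.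
by move=> e _; rewrite /diff; ring.
Qed.

(** Induction on the degree: the increments in n are averages of the same quantity for the harmonic
    functions [diff e u], and summing them in n moves each coefficient up by one index. *)
Lemma harmonic_absolutely_monotone M u :
  (forall x, laplacian u x = 0) -> diff_degree_le M u -> forall x,
  exists a : nat -> R, (forall k, 0 <= a k) /\
    forall n, iter n neighbour_mean (fun y => u y ^+ 2) x =
              \sum_(k < M.+1) a k * 'C(n, k)%:R.
Proof.
move=> hu hM x; elim: M u hu hM => [|M IHM] u hu hM.
  exists (fun=> u x ^+ 2); split=> [k|n]; first exact: sqr_ge0.
  rewrite big_ord1 bin0 mulr1; elim: n => // n <-; rewrite iterSr.
  congr (iter n _ _ x); apply/funext => y; apply/eqP.
  rewrite -subr_eq0 neighbour_mean_sqr_harmonic// big1 ?mulr0// => e _.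
  by rewrite /diff hM subrr expr0n.
have /choice[b hb] : forall e, exists a : nat -> R, (forall k, 0 <= a k) /\
    forall n, iter n neighbour_mean (fun y => diff e u y ^+ 2) x =
              \sum_(k < M.+1) a k * 'C(n, k)%:R.
  by move=> e; apply: IHM => //; exact: harmonic_diff.
pose c k := (2 * d)%:R^-1 * \sum_e b e k.
(* The value at n = 0 is the constant coefficient; the averaged coefficients of the differences
   follow, shifted by one. *)
exists (fun k => if k is j.+1 then c j else u x ^+ 2); split=> [[|k]|n].
- exact: sqr_ge0.
- by rewrite mulr_ge0 ?invr_ge0// sumr_ge0// => e _; exact: (hb e).1.
have step m : iter m.+1 neighbour_mean (fun y => u y ^+ 2) x -
    iter m neighbour_mean (fun y => u y ^+ 2) x = \sum_(k < M.+1) c k * 'C(m, k)%:R.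
  rewrite iterSr iter_neighbour_meanB.
  under [X in iter _ _ X _]funext do rewrite neighbour_mean_sqr_harmonic//.
  rewrite iter_neighbour_mean_average.
  under eq_bigr do rewrite (hb _).2.
  rewrite exchange_big big_distrr /=; apply: eq_bigr => k _.
  by rewrite /c -mulrA big_distrl.
elim: n => [|n IHn].
  by rewrite big_ord_recl bin0 mulr1 big1 ?addr0// => k _; rewrite bin0n mulr0.
rewrite -[LHS](subrK (iter n neighbour_mean (fun y => u y ^+ 2) x)) step IHn.
rewrite [X in _ + X = _]big_ord_recl [RHS]big_ord_recl !bin0 addrCA; congr (_ + _).
(* Pascal's rule absorbs the increment. *)
by rewrite -big_split /=; apply: eq_bigr => k _; rewrite binS natrD; ring.
Qed.

End Differences.

(** * Cauchy-Schwarz and the comparison of binomial coefficients *)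

(** Cauchy-Schwarz for terms bounded by geometric means, stated without square roots and proved by
    adding one term at a time. *)
Lemma sqr_sumr_le {R : realType} (I : Type) (r : seq I) (s p q : I -> R) :
  (forall i, 0 <= s i) -> (forall i, 0 <= p i) -> (forall i, 0 <= q i) ->
  (forall i, s i ^+ 2 <= p i * q i) ->
  (\sum_(i <- r) s i) ^+ 2 <= (\sum_(i <- r) p i) * (\sum_(i <- r) q i).
Proof.
move=> s0 p0 q0 h; elim: r => [|i r IHr]; first by rewrite !big_nil expr0n mul0r.
rewrite !big_cons.
set S := \sum_(j <- r) s j in IHr *; set A := \sum_(j <- r) p j in IHr *.
set B := \sum_(j <- r) q j in IHr *.
have S0 : 0 <= S by exact: sumr_ge0.
have A0 : 0 <= A by exact: sumr_ge0.
have B0 : 0 <= B by exact: sumr_ge0.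
(* The mixed term is handled by AM-GM: (2sS)^2 <= 4(pB)(Aq) <= (pB + Aq)^2. *)
have cross : 2 * (s i * S) <= p i * B + A * q i.
  rewrite -(@ler_pXn2r _ 2)// ?nnegrE ?addr_ge0 ?mulr_ge0//.
  have : (s i * S) ^+ 2 <= (p i * q i) * (A * B).
    by rewrite exprMn ler_pM// sqr_ge0.
  have := sqr_ge0 (p i * B - A * q i); nra.
have := h i; nra.
Qed.

(** Multiplying by (k!)^2 turns the binomials into falling factorials, which are compared factor by
    factor; each factor costs at most 1 + M/n. *)
Lemma sqr_bin_double_le {R : realType} (n M k : nat) :
  (2 * M <= n)%N -> (k <= M)%N ->
  'C(2 * n, k)%:R ^+ 2 <= (1 + M%:R / n%:R) ^+ k * ('C(n, k)%:R * 'C(4 * n, k)%:R) :> R.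
Proof.
move=> Mn kM; have [n00|n0] := posnP n.
  have -> : k = 0%N by move: Mn; rewrite n00; lia.
  by rewrite expr0 !bin0 expr1n !mul1r.
have ffact_le j : (j <= M)%N -> ((2 * n) ^_ j)%:R ^+ 2 <=
    (1 + M%:R / n%:R) ^+ j * ((n ^_ j)%:R * ((4 * n) ^_ j)%:R) :> R.
  elim: j => [|j IHj] jM; first by rewrite expr0 !ffactn0 expr1n !mul1r.
  rewrite !ffactnSr !natrM exprMn (exprS _ j).
  have factor : (2 * n - j)%:R ^+ 2 <=
      (1 + M%:R / n%:R) * ((n - j)%:R * (4 * n - j)%:R) :> R.
    have n0' : 0 < n%:R :> R by rewrite ltr0n.
    rewrite -(ler_pM2l n0') [leRHS]mulrA mulrDr mulr1 [n%:R * (M%:R / _)]mulrCA mulfV ?gt_eqF// mulr1.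
    (* (2n - j)^2 = (n - j)(4n - j) + nj, and nj <= (M/n)(n - j)(4n - j). *)
    rewrite -natrX -!natrM -natrD -!natrM ler_nat.
    (* Since j < M and 2M <= n, these substitutions remove the truncated subtractions; the
       difference of the two sides becomes a polynomial with nonnegative coefficients. *)
    have [i ->] : exists i, n = (2 * j + i)%N by exists (n - 2 * j)%N; lia.
    have [l ->] : exists l, M = (j + l)%N by exists (M - j)%N; lia.
    rewrite (_ : 2 * _ - j = 3 * j + 2 * i)%N; last by lia.
    rewrite (_ : _ + i - j = j + i)%N; last by lia.
    rewrite (_ : 4 * _ - j = 7 * j + 4 * i)%N; last by lia.
    nia.
  apply: le_trans (ler_pM _ _ (IHj (ltnW jM)) factor) _; rewrite ?sqr_ge0//.
  by rewrite le_eqVlt; apply/orP; left; apply/eqP; ring.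
have := ffact_le k kM; rewrite -!bin_ffact !natrM.
have f0 : 0 < (k`!)%:R ^+ 2 :> R by rewrite exprn_gt0// ltr0n fact_gt0.
move=> h; rewrite -(ler_pM2r f0) -exprMn; apply: le_trans h _.
by rewrite le_eqVlt; apply/orP; left; apply/eqP; ring.
Qed.

(** * Assembling the doubling inequality *)

Unset Implicit Arguments.

Theorem theorem1p12 (R : realType) (d : nat) (hd : (0 < d)%N)
    (disp : measure_display) (T : measurableType disp) (P : probability T R)
    (X : nat -> T -> 'rV[int]_d) (hX : simple_random_walk P X)
    (M : nat) (u : 'rV[int]_d -> R) (hu : harmonic_polynomial M u)
    (eps : R) (heps : 0 <= eps < 2^-1)
    (n : nat) (hnM : M%:R ^+ 2 < n%:R `^ (1 - 2 * eps)) (hn : (16 < n)%N) :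
  Q P X u (2 * n) <=
    Num.sqrt (expR (n%:R `^ (- (2 * eps))) * Q P X u n * Q P X u (4 * n)).
Proof.
case: hu => -[p [size_p u_p]] u_harmonic.
have u_deg : diff_degree_le M u.
  by rewrite -size_p (funext u_p); exact: diff_degree_le_meval.
have [a [a0 u_a]] := harmonic_absolutely_monotone hd u_harmonic u_deg 0.
have QE m : Q P X u m = \sum_(k < M.+1) a k * 'C(m, k)%:R.
  by rewrite /Q (expectation_walk hd hX (f := fun x => u x ^+ 2)) => [|x]; [rewrite u_a|exact: sqr_ge0].
have n0 : 0 < n%:R :> R by rewrite ltr0n (ltn_trans _ hn).
have pow_n : n%:R `^ (1 - 2 * eps) = n%:R * n%:R `^ (- (2 * eps)) :> R.
  by rewrite powRD ?powRr1 ?ler0n//; apply/implyP => _; rewrite gt_eqF.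
have M2n : (M ^ 2 < n)%N.
  rewrite -(ltr_nat R) natrX (lt_le_trans hnM)// -[leRHS]powRr1 ?ler0n//.
  by apply: ler_powR; [rewrite ler1n (ltn_trans _ hn)|lra].
(* Indeed 2M <= M^2 + 1 <= n. *)
have Mn : (2 * M <= n)%N by nia.
(* By 1 + t <= e^t at t = M/n, the power is at most exp(M^2/n), and dividing [hnM] by n gives M^2/n
   < n^(-2 eps). *)
have growth k : (k <= M)%N ->
    (1 + M%:R / n%:R) ^+ k <= expR (n%:R `^ (- (2 * eps))) :> R.
  move=> kM; have Mn0 : 0 <= M%:R / n%:R :> R by rewrite divr_ge0.
  apply: (@le_trans _ _ ((1 + M%:R / n%:R) ^+ M)).
    by rewrite ler_weXn2l// lerDl.
  apply: (@le_trans _ _ (expR (M%:R / n%:R) ^+ M)).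
    by rewrite lerXn2r ?nnegrE ?addr_ge0 ?expR_ge0 ?expR_ge1Dx.
  rewrite -expRM_natl ler_expR mulrA -expr2 ler_pdivrMr// mulrC -pow_n.
  exact: ltW.
have Q0 m : 0 <= Q P X u m by rewrite QE sumr_ge0// => k _; rewrite mulr_ge0.
(* As Q is nonnegative, the squares can be compared; the exponential is moved into the sum for Q(n)
   so that Cauchy-Schwarz applies term by term. *)
rewrite -[leLHS]ger0_norm// -sqrtr_sqr ler_wsqrtr// !QE [expR _ * _]big_distrr /=.
apply: sqr_sumr_le => k; rewrite ?mulr_ge0 ?expR_ge0//.
have kM : (k <= M)%N by rewrite -ltnS.
have := le_trans (sqr_bin_double_le (R := R) Mn kM)
  (ler_wpM2r (mulr_ge0 (ler0n _ _) (ler0n _ _)) (growth k kM)).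
move=> /(ler_wpM2l (sqr_ge0 (a k))).
by rewrite -exprMn => /le_trans; apply; rewrite le_eqVlt; apply/orP; left;
  apply/eqP; ring.
Qed.
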